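(* There exist absolute constants $c,C>0$ such that for every $n\in\mathbb N$, if $K\subseteq\mathbb R^n$ is a convex body with $B_2^n\subseteq K$, $q\geq1$, and $N\in\mathbb N$ satisfies $(C\,D_q(K))^2\leq N\leq e^q$, then $$\int_{O(n)}\frac{1}{(G_n(UK))^N}\sum_{x_1,\ldots,x_N\in UK\cap\mathbb Z^n}\max_{1\leq i\leq N}|\langle x_i,e_n\rangle|\,d\nu(U)\geq c\int_{O(n)}\left(\frac{1}{G_n(UK)}\sum_{x\in UK\cap\mathbb Z^n}|\langle x,e_n\rangle|^{\frac{\log N}{2\log(C D_q(K))}}\right)^{\frac{2\log(C D_q(K))}{\log N}}d\nu(U).$$
   Context: A convex body is a compact convex subset of $\mathbb R^n$ with non-empty interior. $(e_i)_{i=1}^n$ is the canonical basis of $\mathbb R^n$, $B_2^n$ is the closed Euclidean unit ball, $O(n)$ is the group of orthogonal $n\times n$ matrices, $\nu$ is its Haar probability measure, and $\log$ is the natural logarithm. For a bounded set $L\subseteq\mathbb R^n$, $G_n(L)$ is the cardinality of $L\cap\mathbb Z^n$. Put $C_n=(-1,1)^n$; sums of sets are Minkowski sums. For a convex body $L\subseteq\mathbb R^n$ with $\max_{x\in L\cap\mathbb Z^n}|\langle x,e_n\rangle|\geq 1$ and $p\geq1$, define $$D_0(L,p):=\frac{1+\left(\mathbb E|\langle Y,e_n\rangle|^p\right)^{\frac1p}\left(\frac{G_n(L+C_n)}{G_n(L)}\right)^{\frac1p}}{\left(\mathbb E|\langle X,e_n\rangle|^p\right)^{\frac1p}},$$ where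 $X$ is uniformly distributed on the finite set $L\cap\mathbb Z^n$ and $Y$ is uniformly distributed on the finite set $(L+C_n)\cap\mathbb Z^n$. For a convex body $L\subseteq\mathbb R^n$ with $B_2^n\subseteq L$ and $q\geq1$, define $$D_q(L):=\sup_{U\in O(n),\ 1\leq p\leq q}D_0(UL,p).$$ The sum on the left-hand side of the claim runs over all $N$-tuples in $(UK\cap\mathbb Z^n)^N$. Absolute constants are numbers independent of all parameters ($n$, $K$, $q$, $N$). *)

(* Defs.v *)
From mathcomp Require Export all_boot all_order all_algebra finmap.
From mathcomp Require Export all_classical all_reals all_analysis.
Export Order.TTheory GRing.Theory Num.Theory.
Export numFieldNormedType.Exports.

Set Implicit Arguments.
Unset Strict Implicit.
Unset Printing Implicit Defensive.

Local Open Scope classical_set_scope.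
Local Open Scope ring_scope.

(* R^n is 'cV[R]_n, with n = m.+1 wherever the last basis vector e_n is used. *)

Definition dot (R : realType) (n : nat) (x y : 'cV[R]_n) : R :=
  (x^T *m y) ord0 ord0.

Definition last_basis (R : realType) (m : nat) : 'cV[R]_m.+1 :=
  delta_mx ord_max ord0.

(* The norm of the library on 'cV[R]_n is the sup norm (its topology is the
   usual one), so the Euclidean ball is written out. *)
Definition euclidean_ball (R : realType) (n : nat) : set 'cV[R]_n :=
  [set x | Num.sqrt (dot x x) <= 1].

Definition convex_body (R : realType) (n : nat) (K : set 'cV[R]_n) : Prop :=
  [/\ compact K, @convex_set R 'cV[R]_n K & K° !=set0].

Definition open_cube (R : realType) (n : nat) : set 'cV[R]_n :=
  [set x | forall i, -1 < x i ord0 < 1].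

Definition minkowski_sum (R : realType) (n : nat) (A B : set 'cV[R]_n) :
    set 'cV[R]_n :=
  [set x + y | x in A & y in B].

Definition integer_lattice (R : realType) (n : nat) : set 'cV[R]_n :=
  [set x | forall i, x i ord0 \is a Num.int].

Definition lattice_points (R : realType) (n : nat) (L : set 'cV[R]_n) :
    set 'cV[R]_n :=
  L `&` @integer_lattice R n.

(* Only meaningful for bounded L: fset_set sends an infinite set to fset0. *)
Definition G (R : realType) (n : nat) (L : set 'cV[R]_n) : nat :=
  #|` fset_set (lattice_points L)|.

(* E f(X) for X uniformly distributed on the lattice points of a bounded L. *)
Definition lattice_expectation (R : realType) (n : nat) (L : set 'cV[R]_n)
    (f : 'cV[R]_n -> R) : R :=
  (G L)%:R^-1 * \sum_(x \in lattice_points L) f x.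

Definition mx_image (R : realType) (n : nat) (U : 'M[R]_n) (L : set 'cV[R]_n) :
    set 'cV[R]_n :=
  [set U *m x | x in L].

Definition orthogonal_group (R : realType) (n : nat) : set 'M[R]_n :=
  [set U | U^T *m U = 1%:M].

Definition D0 (R : realType) (m : nat) (L : set 'cV[R]_m.+1) (p : R) : R :=
  let LC := minkowski_sum L (@open_cube R m.+1) in
  let h (x : 'cV[R]_m.+1) := `|dot x (last_basis R m)| `^ p in
  (1 + (lattice_expectation LC h) `^ p^-1
       * ((G LC)%:R / (G L)%:R) `^ p^-1)
  / (lattice_expectation L h) `^ p^-1.

(* When L is a convex body containing the Euclidean unit ball and 1 <= q, the
   set below is nonempty and bounded, so that this is a genuine supremum
   (sup is 0 by convention on unbounded or empty sets). *)
Definition D (R : realType) (m : nat) (q : R) (L : set 'cV[R]_m.+1) : R :=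
  sup [set r | exists U : 'M[R]_m.+1, exists p : R,
         [/\ orthogonal_group U, 1 <= p <= q & r = D0 (mx_image U L) p]].

Definition borel_matrix (R : realType) (n : nat) :
    measurableType (sigma_display (@open 'M[R]_n)) :=
  g_sigma_algebraType (@open 'M[R]_n).

(* The Haar probability measure of O(n), seen as a Borel probability measure on
   n x n matrices carried by O(n): the Borel sets of the (closed) subspace O(n)
   are exactly the Borel sets of matrices contained in it. *)
Definition haar_orthogonal (R : realType) (n : nat)
    (nu : probability (borel_matrix R n) R) : Prop :=
  nu (@orthogonal_group R n) = 1%E /\
  forall (V : 'M[R]_n) (A : set (borel_matrix R n)),
    orthogonal_group V -> measurable A -> A `<=` @orthogonal_group R n ->
    nu [set V *m U | U in A] = nu A.

Definition lattice_tuples (R : realType) (n N : nat) (L : set 'cV[R]_n) :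
    set {ffun 'I_N -> 'cV[R]_n} :=
  [set x | forall i, lattice_points L (x i)].

(* Main.v *)
(* The inequality holds pointwise in U, with C = 16 and c = 1/4.  Write L = UK,
   S = L /\ Z^n, T = (L + C_n) /\ Z^n and a(x) = |<x, e_n>|.

   If f(x) g(y) <= h(z)^2 whenever |2 z_i - x_i - y_i| <= 1 for all i, then
   (sum f) (sum g) <= (sum h)^2 on Z^n: a discrete midpoint Prekopa-Leindler
   inequality, which tensorizes and is a layer-cake consequence of
   |A| + |B| <= 2 |mid(A, B)| in dimension one.

   Let M^p = (sum_T a^p) / |S|.  By Markov, the set where a <= 2 M contains at
   least half of S.  Apply the inequality to f = a^(2p) on the points of S with
   a > 4 M + 2, g = the indicator of that half and h = (4 a)^p on T; all the
   midpoints involved lie in T by convexity of L.  This gives a reverse Hoelder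
   inequality E a^(2p) <= 3 (4 (M + 1))^(2p), and 1 + M <= D_q(K) (E a^p)^(1/p)
   by definition of D_q(K).

   Paley-Zygmund then yields P(a >= (E a^p)^(1/p) / 2) >= 1/N when
   (16 D_q(K))^(2p) = N, so that one of N independent copies of a exceeds this
   level with probability at least 1 - 1/e. *)

Require Import Defs.
From mathcomp Require Import ring lra zify.

Set Implicit Arguments.
Unset Strict Implicit.
Unset Printing Implicit Defensive.

Local Open Scope classical_set_scope.
Local Open Scope ring_scope.

(** * Cardinality of midpoint sets in dimension one *)

(** The condition [|x + y - 2 z| <= 1], free of subtraction in [nat]. For [x + y] odd both roundings
    of the midpoint qualify, which is what makes twice the size of a midpoint set reach
    [|A| + |B|]. *)
Definition near_mid (x y z : nat) : bool :=
  ((x + y <= z.*2.+1) && (z.*2 <= (x + y).+1))%N.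

Lemma near_mid_uphalf (x y : nat) : near_mid x y (uphalf (x + y)).
Proof. by rewrite /near_mid; lia. Qed.

Lemma near_mid_half (x y : nat) : near_mid x y ((x + y)./2).
Proof. by rewrite /near_mid; lia. Qed.

Lemma set_max (M : nat) (A : {set 'I_M}) : A != finset.set0 ->
  exists2 a, a \in A & forall x, x \in A -> (x <= a)%N.
Proof.
case/set0Pn => x0 Ax0; case: (arg_maxnP (fun i : 'I_M => val i) Ax0) => a Aa am.
by exists a.
Qed.

(** The two largest points of [A] are deleted together against the single midpoint [c]: the
    remaining points are at most [a - 2], so their midpoints with [b] stay below [c]. Deleting [a]
    alone would not do, since a midpoint of [a - 1] and [b] may round up to [c]. *)
Lemma card_midset_single (M : nat) (A T : {set 'I_M}) (b : 'I_M) :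
  A != finset.set0 -> (forall x z : 'I_M, x \in A -> near_mid x b z -> z \in T) ->
  (#|A|.+1 <= #|T|.*2)%N.
Proof.
elim: {A}_.+1 {-2}A (ltnSn #|A|) T => // k IH A; rewrite ltnS => Ak T A0 AT.
have [a Aa amax] := set_max A0.
have cM : (uphalf (a + b) < M)%N by have := ltn_ord a; have := ltn_ord b; lia.
have [c cE] : exists c : 'I_M, c = uphalf (a + b) :> nat by exists (Ordinal cM).
have Tc : c \in T by apply: (AT a) => //; rewrite cE; exact: near_mid_uphalf.
have cardT := cardsD1 c T; rewrite Tc in cardT.
have cardA := cardsD1 a A; rewrite Aa in cardA.
have [A1|A1] := eqVneq (A :\ a)%SET finset.set0.
  by rewrite cardA A1 cards0 cardT; lia.
have [a2 Aa2 a2max] := set_max A1.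
have a2a : (a2 < a)%N.
  by move: Aa2; rewrite in_setD1 => /andP[ne /amax]; move: ne; rewrite -val_eqE /=; lia.
have cardA1 := cardsD1 a2 (A :\ a)%SET; rewrite Aa2 in cardA1.
have Aa2' : a2 \in A by move: Aa2; rewrite in_setD1 => /andP[].
(* Two points require two midpoints: [a2 + b] rounded down differs from [c], which is [a + b]
   rounded up. *)
have [A2|A2] := eqVneq ((A :\ a) :\ a2)%SET finset.set0.
  have dM : ((a2 + b)./2 < M)%N by have := ltn_ord a; have := ltn_ord b; lia.
  have Td : Ordinal dM \in (T :\ c)%SET.
    rewrite in_setD1 -val_eqE /= (AT a2) ?andbT //; last exact: near_mid_half.
    by rewrite cE; apply/eqP; lia.
  have := cardsD1 (Ordinal dM) (T :\ c)%SET; rewrite Td.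
  by rewrite cardA cardA1 A2 cards0 cardT => ->; lia.
suff : (#|(A :\ a) :\ a2|.+1 <= #|T :\ c|.*2)%N.
  by rewrite cardA cardA1 cardT; move: #|_ :\ a2| #|_ :\ c| => k1 k2; lia.
apply: IH A2 _ => //; first by move: Ak; rewrite cardA cardA1; move: #|_ :\ a2| => k1; lia.
move=> x z; rewrite !in_setD1 => /and3P[xa2 xa Ax] xbz.
rewrite (AT x) // andbT -val_eqE /=.
have xlt : (x <= a2)%N by apply: a2max; rewrite in_setD1 xa.
move: xa2 xbz; rewrite /near_mid -val_eqE /= => xa2; apply: contraTneq => ->.
by rewrite cE; lia.
Qed.

(* Deleting the two maxima [a], [b] removes [uphalf (a + b)] from the midpoints. *)
Lemma card_midset (M : nat) (A B T : {set 'I_M}) :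
  A != finset.set0 -> B != finset.set0 ->
  (forall x y z : 'I_M, x \in A -> y \in B -> near_mid x y z -> z \in T) ->
  (#|A| + #|B| <= #|T|.*2)%N.
Proof.
elim: {A}_.+1 {-2}A (ltnSn #|A|) B T => // k IH A; rewrite ltnS => Ak B T A0 B0 ABT.
have [a Aa amax] := set_max A0.
have [b Bb bmax] := set_max B0.
have cM : (uphalf (a + b) < M)%N by have := ltn_ord a; have := ltn_ord b; lia.
have [c cE] : exists c : 'I_M, c = uphalf (a + b) :> nat by exists (Ordinal cM).
have Tc : c \in T by apply: (ABT a b) => //; rewrite cE; exact: near_mid_uphalf.
have cardT := cardsD1 c T; rewrite Tc in cardT.
have cardA := cardsD1 a A; rewrite Aa in cardA.
have cardB := cardsD1 b B; rewrite Bb in cardB.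
have [A1|A1] := eqVneq (A :\ a)%SET finset.set0.
  suff : (#|B|.+1 <= #|T|.*2)%N by rewrite cardA A1 cards0; move: #|B| #|T| => k1 k2; lia.
  apply: (@card_midset_single _ B T a) => //.
  move=> x z Bx xz; apply: (ABT a x) => //; move: xz; rewrite /near_mid; lia.
have [B1|B1] := eqVneq (B :\ b)%SET finset.set0.
  suff : (#|A|.+1 <= #|T|.*2)%N by rewrite cardB B1 cards0; move: #|A| #|T| => k1 k2; lia.
  apply: (@card_midset_single _ A T b) => //.
  by move=> x z Bx xz; apply: (ABT x b).
suff : (#|A :\ a| + #|B :\ b| <= #|T :\ c|.*2)%N.
  by rewrite cardA cardB cardT; move: #|_ :\ a| #|_ :\ b| #|_ :\ c| => k1 k2 k3; lia.
apply: IH A1 B1 _ => //; first by move: Ak; rewrite cardA; move: #|_ :\ a| => k1; lia.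
move=> x y z; rewrite !in_setD1 => /andP[xa Ax] /andP[yb By] xyz.
rewrite (ABT x y) // andbT.
have {}Ax := amax _ Ax; have {}By := bmax _ By.
(* Here [x <= a - 1] and [y <= b - 1] force [2 z <= a + b - 1 < 2 c]. *)
move: xa yb xyz; rewrite /near_mid -!val_eqE /= => xa yb; apply: contraTneq => ->.
by rewrite cE; lia.
Qed.

(** * From cardinalities to sums in dimension one *)

Lemma sum_indicator (R : realType) (X : finType) (A : {set X}) (e : R) :
  \sum_x e * (x \in A)%:R = e * #|A|%:R.
Proof.
rewrite -mulr_sumr -sum1_card natr_sum [in RHS]big_mkcond /=; congr (_ * _).
by apply: eq_bigr => x _; case: ifP.
Qed.

(* Layer-cake form of [card_midset], peeling off the lowest positive layer. *)
Lemma sum_midmin (R : realType) (M : nat) (f g h : 'I_M -> R) (x0 y0 : 'I_M) :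
  (forall x, 0 <= f x <= f x0) -> (forall y, 0 <= g y <= g y0) ->
  f x0 = g y0 -> (forall z, 0 <= h z) ->
  (forall x y z : 'I_M, near_mid x y z -> Num.min (f x) (g y) <= h z) ->
  \sum_x f x + \sum_y g y <= (\sum_z h z) *+ 2.
Proof.
pose s (u : 'I_M -> R) := [set x | 0 < u x]%SET.
elim: {f g}_.+1 {-2}f {-2}g (ltnSn (#|s f| + #|s g|)) h => // k IH f g.
rewrite ltnS => fgk h f0 g0 fg0 h0 fgh.
(* Since the maxima are equal, [f] and [g] vanish together; otherwise both supports are nonempty, as
   [card_midset] requires. *)
have [fx0|fx0] := leP (f x0) 0.
  rewrite (big1 _ _ (fun x => f x)) ?(big1 _ _ (fun x => g x)) => [|x _|x _].
  - by rewrite addr0 mulrn_wge0 // sumr_ge0.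
  - by apply/le_anti; have /andP[-> /le_trans->] := g0 x; rewrite // -fg0.
  - by apply/le_anti; have /andP[-> /le_trans->] := f0 x.
have x0A : x0 \in s f by rewrite inE.
have y0B : y0 \in s g by rewrite inE -fg0.
case: (arg_minP f x0A) => a; rewrite -[_ a]/(a \in s f) => aA amin.
case: (arg_minP g y0B) => b; rewrite -[_ b]/(b \in s g) => bB bmin.
pose e := Num.min (f a) (g b).
have e0 : 0 < e by move: aA bB; rewrite !inE /e lt_min => -> ->.
pose T := [set z : 'I_M | [exists x in s f, exists y in s g, near_mid x y z]]%SET.
have fA x : x \in s f -> e <= f x by move=> /amin; apply: le_trans; rewrite /e ge_min lexx.
have gB x : x \in s g -> e <= g x by move=> /bmin; apply: le_trans; rewrite /e ge_min lexx orbT.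
have fN x : x \notin s f -> f x = 0.
  by rewrite inE -leNgt => fx; apply/le_anti; rewrite fx (andP (f0 x)).1.
have gN x : x \notin s g -> g x = 0.
  by rewrite inE -leNgt => fx; apply/le_anti; rewrite fx (andP (g0 x)).1.
have hT z : z \in T -> e <= h z.
  rewrite inE => /exists_inP[x xA] /exists_inP[y yB] /fgh; apply: le_trans.
  by rewrite le_min fA ?gB.
pose f' x := f x - e * (x \in s f)%:R.
pose g' x := g x - e * (x \in s g)%:R.
pose h' x := h x - e * (x \in T)%:R.
have f'E x : f' x = if x \in s f then f x - e else 0.
  by rewrite /f'; case: ifPn => [_|/fN ->]; rewrite ?mulr1 ?mulr0 ?subr0.
have g'E x : g' x = if x \in s g then g x - e else 0.
  by rewrite /g'; case: ifPn => [_|/gN ->]; rewrite ?mulr1 ?mulr0 ?subr0.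
have h'E x : h' x = if x \in T then h x - e else h x.
  by rewrite /h'; case: ifPn => _; rewrite ?mulr1 ?mulr0 ?subr0.
have h'0 z : 0 <= h' z by rewrite h'E; case: ifPn => [/hT|]; rewrite ?subr_ge0.
have card : (#|s f| + #|s g| <= #|T|.*2)%N.
  apply: card_midset; [by apply/set0Pn; exists x0|by apply/set0Pn; exists y0|].
  move=> x y z xA yB xyz; rewrite inE; apply/exists_inP; exists x => //.
  by apply/exists_inP; exists y.
have sf' : s f' \subset s f.
  by apply/fintype.subsetP => x; rewrite [x \in s f']inE f'E; case: ifP => //; rewrite ltxx.
have sg' : s g' \subset s g.
  by apply/fintype.subsetP => x; rewrite [x \in s g']inE g'E; case: ifP => //; rewrite ltxx.
have IH' : \sum_x f' x + \sum_y g' y <= (\sum_z h' z) *+ 2.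
  apply: IH => //.
  (* The point at which [e] is attained leaves its support, so the total size drops. *)
  - apply: leq_trans fgk; have [ab|ba] := leP (f a) (g b).
      rewrite -addSn leq_add ?subset_leq_card//; apply: proper_card.
      apply/properP; split => //; exists a => //.
      by rewrite inE f'E aA /e min_l // subrr ltxx.
    rewrite -addnS leq_add ?subset_leq_card//; apply: proper_card.
    apply/properP; split => //; exists b => //.
    by rewrite inE g'E bB /e min_r ?ltW // subrr ltxx.
  - move=> x; rewrite !f'E x0A; case: ifPn => [xA|_].
      by rewrite subr_ge0 fA // lerB // (andP (f0 x)).2.
    by rewrite lexx subr_ge0 fA.
  - move=> x; rewrite !g'E y0B; case: ifPn => [xA|_].
      by rewrite subr_ge0 gB // lerB // (andP (g0 x)).2.
    by rewrite lexx subr_ge0 gB.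
  - by rewrite f'E g'E x0A y0B fg0.
  (* Off either support the new minimum is at most 0; on both, [z] lies in [T] and all three values
     drop by [e]. *)
  - move=> x y z xyz; rewrite f'E g'E.
    case: ifPn => xA; last by rewrite ge_min h'0.
    case: ifPn => yB; last by rewrite ge_min h'0 orbT.
    have zT : z \in T.
      by rewrite inE; apply/exists_inP; exists x => //; apply/exists_inP; exists y.
    by have := fgh _ _ _ xyz; rewrite h'E zT !ge_min !lerD2r.
have : e * #|s f|%:R + e * #|s g|%:R <= (e * #|T|%:R) *+ 2.
  rewrite -mulrDr -mulrnAr ler_pM2l // -natrD -mulrnA muln2.
  by rewrite ler_nat.
move: IH'; rewrite !big_split /= !sumrN !sum_indicator.
by move: (\sum_x f x) (\sum_x g x) (\sum_x h x) => u v w; rewrite !mulr2n; lra.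
Qed.

(** * The multiplicative midpoint inequality and its tensorization *)

(** Prekopa-Leindler with weight one half, squared to avoid roots. The relation [mid] is a parameter
    so that products of relations are covered. *)
Definition mid_ineq (R : realType) (X : finType) (mid : X -> X -> X -> bool) :=
  forall f g h : X -> R,
    (forall x, 0 <= f x) -> (forall x, 0 <= g x) -> (forall x, 0 <= h x) ->
    (forall x y z, mid x y z -> f x * g y <= h z ^+ 2) ->
    (\sum_x f x) * (\sum_x g x) <= (\sum_x h x) ^+ 2.

(** Dividing [f] and [g] by their maxima makes these equal, as [sum_midmin] demands; AM-GM then
    turns its sum into a product. *)
Lemma mid_ineq_ord (R : realType) (M : nat) :
  @mid_ineq R 'I_M (fun x y z => near_mid x y z).
Proof.
move=> f g h f0 g0 h0 fgh.
case: M f g h f0 g0 h0 fgh => [|M] f g h f0 g0 h0 fgh.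
  by rewrite !big_ord0 mul0r expr0n.
case: (arg_maxP f (erefl true : xpredT (ord0 : 'I_M.+1))) => a _ amax'.
have {amax'} amax x : f x <= f a by exact: amax'.
case: (arg_maxP g (erefl true : xpredT (ord0 : 'I_M.+1))) => b _ bmax'.
have {bmax'} bmax x : g x <= g b by exact: bmax'.
have [fa|fa] := leP (f a) 0.
  rewrite big1 ?mul0r ?sqr_ge0 // => x _; apply/le_anti.
  by rewrite f0 (le_trans (amax x)).
have [gb|gb] := leP (g b) 0.
  rewrite [X in _ * X]big1 ?mulr0 ?sqr_ge0 // => x _; apply/le_anti.
  by rewrite g0 (le_trans (bmax x)).
(* The geometric mean of the maxima is the scale for [h], because [min(u, v)^2 <= u v] for the
   normalized values. *)
pose r := Num.sqrt (f a * g b).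
have r0 : 0 < r by rewrite sqrtr_gt0 mulr_gt0.
have rE : r ^+ 2 = f a * g b by rewrite sqr_sqrtr // mulr_ge0.
have := @sum_midmin R M.+1 (fun x => f x / f a) (fun x => g x / g b) (fun x => h x / r) a b.
rewrite !divff ?gt_eqF // -!mulr_suml => /(_ _ _ erefl _ _) H.
have {}H : (\sum_i f i) / f a + (\sum_i g i) / g b <= ((\sum_i h i) / r) *+ 2.
  apply: H.
  - by move=> x; rewrite divr_ge0 // ler_pdivrMr // mul1r amax.
  - by move=> x; rewrite divr_ge0 // ler_pdivrMr // mul1r bmax.
  - by move=> z; rewrite divr_ge0 // ltW.
  move=> x y z /fgh fghz.
  rewrite -(@ler_pXn2r _ 2) ?nnegrE ?le_min ?divr_ge0 //; last exact: ltW.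
  apply: (@le_trans _ _ (f x / f a * (g y / g b))).
    by rewrite expr2 ler_pM // ?le_min ?divr_ge0 // ge_min lexx ?orbT.
  by rewrite mulrACA -invfM expr_div_n rE ler_pM2r // invr_gt0 mulr_gt0.
have F0 : 0 <= \sum_i f i by rewrite sumr_ge0.
have G0 : 0 <= \sum_i g i by rewrite sumr_ge0.
have H0 : 0 <= \sum_i h i by rewrite sumr_ge0.
have -> : (\sum_i f i) * (\sum_i g i) = ((\sum_i f i) / f a * ((\sum_i g i) / g b)) * (r ^+ 2).
  by rewrite rE; field; rewrite !gt_eqF.
have -> : (\sum_i h i) ^+ 2 = ((\sum_i h i) / r) ^+ 2 * r ^+ 2 by field; rewrite gt_eqF.
rewrite ler_pM2r ?exprn_gt0 //.
have u0 : 0 <= (\sum_i f i) / f a by rewrite divr_ge0.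
have v0 : 0 <= (\sum_i g i) / g b by rewrite divr_ge0.
move: H u0 v0; set u := _ / f a; set v := _ / g b; set w := _ / r.
move: u v w => u v w uvw u0 v0.
have : (u + v) ^+ 2 <= (w *+ 2) ^+ 2.
  have uv0 : 0 <= u + v by rewrite addr_ge0.
  by rewrite ler_pXn2r ?nnegrE // (le_trans uv0 uvw).
have := sqr_ge0 (u - v); rewrite mulr2n; nra.
Qed.

(** Applied on fibres, [HY] yields exactly the hypothesis that [HX] requires of the three
    marginals. *)
Lemma mid_ineq_prod (R : realType) (X Y : finType) mX mY :
  @mid_ineq R X mX -> @mid_ineq R Y mY ->
  @mid_ineq R (X * Y)%type (fun x y z => mX x.1 y.1 z.1 && mY x.2 y.2 z.2).
Proof.
move=> HX HY f g h f0 g0 h0 fgh.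
have E (u : X * Y -> R) : \sum_x u x = \sum_x \sum_y u (x, y).
  by rewrite pair_big; apply: eq_bigr => -[].
rewrite !E; apply: HX => [x|x|x|x y z xyz]; rewrite ?sumr_ge0 //.
by apply: HY => // x' y' z' xyz'; apply: fgh; rewrite xyz xyz'.
Qed.

Lemma mid_ineq_tuple (R : realType) (M n : nat) :
  @mid_ineq R (n.-tuple 'I_M) (fun x y z => [forall i, near_mid (tnth x i) (tnth y i) (tnth z i)]).
Proof.
elim: n => [|n IH] f g h f0 g0 h0 fgh.
  have E (u : 0.-tuple 'I_M -> R) : \sum_x u x = u [tuple].
    by rewrite (big_pred1 [tuple]) // => x; rewrite (tuple0 x); apply/esym/eqP.
  by rewrite !E; apply: fgh; apply/forallP => -[].
pose c (p : 'I_M * n.-tuple 'I_M) : n.+1.-tuple 'I_M := [tuple of p.1 :: p.2].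
have E (u : n.+1.-tuple 'I_M -> R) : \sum_x u x = \sum_p u (c p).
  rewrite (reindex c) //; exists (fun t => (thead t, [tuple of behead t])) => t _.
    by rewrite /c /= theadE; case: t => a t; congr pair; exact: val_inj.
  by rewrite /c -tuple_eta.
rewrite !E; apply: (mid_ineq_prod (@mid_ineq_ord R M) IH) => // -[x1 x] [y1 y] [z1 z] /=.
move=> /andP[xyz1 /forallP xyz]; apply: fgh; apply/forallP => i.
by case: (unliftP ord0 i) => [j|] ->; rewrite ?tnthS ?tnth0.
Qed.

(** * Reverse Hoelder inequality and Paley-Zygmund *)

Lemma powR_le (R : realType) (x y p : R) : 0 <= p -> 0 <= x -> x <= y -> x `^ p <= y `^ p.
Proof. by move=> p0 x0 xy; apply: ge0_ler_powR => //; rewrite nnegrE // (le_trans x0). Qed.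

Lemma powR_double (R : realType) (x p : R) : 0 <= x -> x `^ (2 * p) = (x `^ p) ^+ 2.
Proof. by move=> x0; rewrite mulrC powRrM powR_mulrn // powR_ge0. Qed.

Lemma powRK (R : realType) (x p : R) : 0 <= x -> p != 0 -> (x `^ p^-1) `^ p = x.
Proof. by move=> x0 p0; rewrite -powRrM mulVf // powRr1. Qed.

(** The reverse Hoelder inequality. Points with [a x <= 4 M + 2] are bounded trivially, the others
    by the midpoint inequality against the half [A] of [S]; the factor 3 is 1 from the former plus 2
    from the latter. *)
Lemma sum_mid_powR2 (R : realType) (X : finType) mid (S T : {set X}) (a : X -> R) (p M : R) :
  @mid_ineq R X mid -> (forall x, 0 <= a x) ->
  (forall x y z, x \in S -> y \in S -> mid x y z -> z \in T) ->
  (forall x y z, mid x y z -> a x <= 2 * a z + a y + 1) ->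
  S \subset T -> 1 <= p -> 0 < M ->
  \sum_(z in T) a z `^ p <= M `^ p * #|S|%:R ->
  \sum_(x in S) a x `^ (2 * p) <= 3 * (4 * (M + 1)) `^ (2 * p) * #|S|%:R.
Proof.
move=> midX a0 ST amid subST p1 M0 TM.
have p0 : 0 <= p by lra.
have pp0 : 0 <= 2 * p by lra.
have Mp0 : 0 < M `^ p by rewrite powR_gt0.
pose A := [set x in S | a x <= 2 * M]%SET.
pose B := [set x in S | 4 * M + 2 < a x]%SET.
have AS : A \subset S by apply/fintype.subsetP => x; rewrite inE => /andP[].
have BS : B \subset S by apply/fintype.subsetP => x; rewrite inE => /andP[].
have cardA : #|S|%:R <= 2 * #|A|%:R :> R.
  have Markov : (2 * M) `^ p * #|S :\: A|%:R <= M `^ p * #|S|%:R.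
    apply: le_trans TM; rewrite -sum1_card natr_sum mulr_sumr.
    apply: (@le_trans _ _ (\sum_(x in S :\: A) a x `^ p)).
      apply: ler_sum => x; rewrite !inE mulr1 => /andP[xA xS].
      rewrite xS -ltNge in xA.
      by apply: powR_le => //; [rewrite mulr_ge0 // ltW | exact: ltW].
    rewrite [leRHS]big_mkcond [leLHS]big_mkcond /=; apply: ler_sum => x _.
    case: ifP => [|_]; last by case: ifP => _; rewrite ?powR_ge0.
    by rewrite inE => /andP[_ /(fintype.subsetP subST) ->].
  (* As [p >= 1], [2 <= 2^p] turns the Markov bound into a proportion of one half. *)
  have two : 2 * M `^ p <= (2 * M) `^ p.
    rewrite powRM ?(ltW M0) // ler_pM2r // -[leLHS]powRr1 //.
    by apply: ler_powR => //; lra.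
  have {}Markov : 2 * #|S :\: A|%:R <= #|S|%:R :> R.
    rewrite -(ler_pM2l Mp0) mulrA [M `^ p * 2]mulrC; apply: le_trans Markov.
    by rewrite ler_wpM2r.
  have : #|S|%:R = #|A|%:R + #|S :\: A|%:R :> R.
    by rewrite -natrD -(cardsID A S) (finset.setIidPr AS).
  by move: Markov => /[swap] ->; lra.
have SB : \sum_(x in B) a x `^ (2 * p) <= 2 * (4 * M) `^ (2 * p) * #|S|%:R.
  pose f x := if x \in B then a x `^ (2 * p) else 0.
  pose g x : R := if x \in A then 1 else 0.
  pose h x := if x \in T then (4 * a x) `^ p else 0.
  have := midX f g h; rewrite -!big_mkcond /=.
  have -> : \sum_(x in A) 1 = #|A|%:R :> R by rewrite -sum1_card natr_sum.
  move=> H; have {}H : (\sum_(x in B) a x `^ (2 * p)) * #|A|%:R <=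
      (\sum_(x in T) (4 * a x) `^ p) ^+ 2.
    apply: H => [x|x|x|x y z xyz]; rewrite /f /g /h.
    - by case: ifP; rewrite ?powR_ge0.
    - by case: ifP.
    - by case: ifP; rewrite ?powR_ge0.
    case: ifP => [|_]; last by rewrite mul0r sqr_ge0.
    rewrite inE => /andP[xS xB]; case: ifP => [|_]; last by rewrite mulr0 sqr_ge0.
    rewrite inE => /andP[yS yA]; rewrite (ST _ _ _ xS yS xyz) mulr1.
    rewrite -powR_double ?mulr_ge0 //; apply: powR_le => //.
    (* From [a y <= 2 M] and [4 M + 2 < a x] follows [2 a z >= a x - 2 M - 1 > a x / 2]. *)
    by have := amid _ _ _ xyz; lra.
  have E : \sum_(x in T) (4 * a x) `^ p = 4 `^ p * \sum_(z in T) a z `^ p.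
    by rewrite mulr_sumr; apply: eq_bigr => x _; rewrite powRM.
  have {}H : (\sum_(x in B) a x `^ (2 * p)) * #|A|%:R <= (4 * M) `^ (2 * p) * #|S|%:R ^+ 2.
    apply: le_trans H _; rewrite E powR_double ?mulr_ge0 ?(ltW M0) // powRM ?(ltW M0) //.
    rewrite -exprMn ler_pXn2r ?nnegrE ?mulr_ge0 ?powR_ge0 ?sumr_ge0 // => [|x _].
      by rewrite -mulrA ler_wpM2l ?powR_ge0.
    exact: powR_ge0.
  have [S0|S0] := posnP #|S|.
    have -> : B = finset.set0.
      by apply/eqP; rewrite -cards_eq0 -leqn0 -S0 subset_leq_card.
    by rewrite big_set0 !mulr_ge0 ?powR_ge0.
  have s0 : 0 < #|S|%:R :> R by rewrite ltr0n.
  rewrite -(ler_pM2r s0).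
  (* Dividing by [|A| >= |S| / 2] costs the factor 2. *)
  apply: (@le_trans _ _ (2 * ((\sum_(x in B) a x `^ (2 * p)) * #|A|%:R))).
    rewrite mulrCA ler_wpM2l // sumr_ge0 // => x _; exact: powR_ge0.
  by rewrite -!mulrA ler_pM2l // -expr2.
have SA : \sum_(x in S :\: B) a x `^ (2 * p) <= (4 * (M + 1)) `^ (2 * p) * #|S|%:R.
  apply: (@le_trans _ _ (\sum_(x in S :\: B) (4 * (M + 1)) `^ (2 * p))).
    apply: ler_sum => x; rewrite !inE => /andP[xB xS].
    by apply: powR_le => //; move: xB; rewrite xS -leNgt; lra.
  rewrite sumr_const -[_ *+ #|_|]mulr_natr ler_wpM2l ?powR_ge0 // ler_nat.
  by rewrite subset_leq_card // finset.subDset finset.subsetUr.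
rewrite (big_setID B) /= (finset.setIidPr BS).
have : 2 * (4 * M) `^ (2 * p) * #|S|%:R <= 2 * (4 * (M + 1)) `^ (2 * p) * #|S|%:R.
  by rewrite ler_wpM2r // ler_pM2l //; apply: powR_le => //; lra.
lra.
Qed.

(* Paley-Zygmund for [a `^ p], with AM-GM in place of Cauchy-Schwarz. *)
Lemma card_ge_Paley_Zygmund (R : realType) (X : finType) (S : {set X}) (a : X -> R) (p k Q t : R) :
  (forall x, 0 <= a x) -> 0 < p -> 0 < k -> 0 < Q -> 0 <= t ->
  \sum_(x in S) a x `^ p = Q * #|S|%:R ->
  \sum_(x in S) a x `^ (2 * p) <= k * Q ^+ 2 * #|S|%:R ->
  t `^ p <= Q / 2 ->
  #|S|%:R <= 4 * k * #|[set x in S | t <= a x]%SET|%:R.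
Proof.
move=> a0 p0 k0 Q0 t0 S1 S2 tQ; set St := [set x in S | _]%SET.
have StS : St \subset S by apply/fintype.subsetP => x; rewrite inE => /andP[].
have low : \sum_(x in S :\: St) a x `^ p <= Q / 2 * #|S|%:R.
  apply: (@le_trans _ _ (\sum_(x in S :\: St) Q / 2)).
    apply: ler_sum => x; rewrite !inE => /andP[xB xS].
    apply: le_trans tQ; apply: powR_le => //; first exact: ltW.
    by move: xB; rewrite xS -ltNge => /ltW.
  rewrite sumr_const -[_ *+ #|_|]mulr_natr ler_wpM2l ?divr_ge0 ?(ltW Q0) // ler_nat.
  by rewrite subset_leq_card // finset.subDset finset.subsetUr.
(* This is [(u - 2 k Q)^2 >= 0], weighted so that the second moment contributes only [Q |S| / 4] in
   total. *)
have AMGM x : a x `^ p <= a x `^ (2 * p) / (4 * k * Q) + k * Q.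
  rewrite powR_double //; move: (a x `^ p) => u.
  have kQ : 0 < 4 * k * Q by rewrite !mulr_gt0.
  rewrite -(ler_pM2r kQ) [leRHS]mulrDl divfK ?gt_eqF //.
  by have := sqr_ge0 (u - 2 * k * Q); nra.
have high : \sum_(x in St) a x `^ p <= Q * #|S|%:R / 4 + k * Q * #|St|%:R.
  apply: (le_trans (ler_sum _ (fun x _ => AMGM x))).
  rewrite big_split /= sumr_const -[_ *+ #|_|]mulr_natr lerD2r -mulr_suml.
  rewrite ler_pdivrMr ?mulr_gt0 //.
  have -> : Q * #|S|%:R / 4 * (4 * k * Q) = k * Q ^+ 2 * #|S|%:R by field.
  apply: le_trans S2; rewrite [leRHS](big_setID St) /= (finset.setIidPr StS) lerDl sumr_ge0 //.
  by move=> x _; exact: powR_ge0.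
move: S1; rewrite (big_setID St) /= (finset.setIidPr StS) => S1.
have : Q * #|S|%:R <= Q * (4 * k * #|St|%:R) by lra.
by rewrite ler_pM2l.
Qed.

(** * The mean maximum of [N] independent copies *)

Lemma expRN1_le_half (R : realType) : expR (-1) <= 2^-1 :> R.
Proof.
rewrite expRN lef_pV2 ?posrE ?expR_gt0 //.
by have := expR_ge1Dx (1 : R); lra.
Qed.

(** A tuple avoids [St] in every coordinate with probability at most [(1 - 1/N)^N <= 1/e <= 1/2]; on
    all other tuples the maximum is at least [t]. Counts replace probabilities, whence the factor
    [|S|^N]. *)
Lemma sum_max_ge (R : realType) (X : finType) (S : {set X}) (a : X -> R) (t : R) (N : nat) :
  (forall x, 0 <= a x) -> 0 <= t -> (0 < N)%N ->
  (#|S| <= N * #|[set x in S | (t <= a x)%R]%SET|)%N ->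
  t / 2 * #|S|%:R ^+ N <=
    \sum_(x : {ffun 'I_N -> X} | [forall i, x i \in S]) \big[Num.max/0]_(i < N) a (x i).
Proof.
move=> a0 t0 N0; set St := [set x in S | _]%SET => SN.
have StS : St \subset S by apply/fintype.subsetP => x; rewrite inE => /andP[].
pose all (V : {set X}) (x : {ffun 'I_N -> X}) := [forall i, x i \in V].
have cardall (V : {set X}) : \sum_(x | all V x) 1 = #|V|%:R ^+ N :> R.
  rewrite -natrX -[N in (_ ^ N)%N]card_ord -card_ffun_on -sum1_card natr_sum.
  by apply: eq_bigl => x; apply/forallP/ffun_onP.
apply: (@le_trans _ _ (\sum_(x | all S x) (t * (~~ all (S :\: St) x)%:R))).
  have -> : \sum_(x | all S x) (t * (~~ all (S :\: St) x)%:R) =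
      t * (#|S|%:R ^+ N - #|S :\: St|%:R ^+ N).
    rewrite -mulr_sumr; congr (_ * _); rewrite -!cardall.
    rewrite [X in _ = _ - X]big_mkcond [X in _ = X - _]big_mkcond [LHS]big_mkcond -sumrB.
    apply: eq_bigr => x _; case: ifPn => [Sx|Sx]; first by case: ifP; rewrite ?subrr ?subr0.
    rewrite ifF ?subr0 //; apply/negbTE; apply: contra Sx => /forallP xD.
    by apply/forallP => i; have := xD i; rewrite inE => /andP[].
  rewrite -mulrA ler_wpM2l //.
  have sN0 : 0 < N%:R :> R by rewrite ltr0n.
  have : #|S :\: St|%:R ^+ N <= #|S|%:R ^+ N * expR (-1) :> R.
    have le1 : #|S :\: St|%:R <= #|S|%:R * expR (- N%:R^-1) :> R.
      apply: (@le_trans _ _ (#|S|%:R * (1 - N%:R^-1))).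
        have -> : #|S|%:R = #|St|%:R + #|S :\: St|%:R :> R.
          by rewrite -natrD -(cardsID St S) (finset.setIidPr StS).
        rewrite mulrBr mulr1.
        have : (#|St|%:R + #|S :\: St|%:R) / N%:R <= #|St|%:R :> R.
          rewrite ler_pdivrMr // -natrD mulrC -natrM ler_nat.
          by rewrite -{1}(finset.setIidPr StS) cardsID.
        lra.
      by rewrite ler_wpM2l // expR_ge1Dx.
    apply: (@le_trans _ _ ((#|S|%:R * expR (- N%:R^-1)) ^+ N)).
      by rewrite ler_pXn2r ?nnegrE ?mulr_ge0 ?expR_ge0.
    by rewrite exprMn -expRM_natr mulNr mulVf ?gt_eqF.
  have := expRN1_le_half R; have : 0 <= #|S|%:R ^+ N :> R by rewrite exprn_ge0.
  by move: (_ ^+ N) (_ ^+ N) (expR _) => u v w; nra.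
apply: ler_sum => x Sx.
have max0 : 0 <= \big[Num.max/0]_(i < N) a (x i).
  by elim/big_ind: _ => // u v u0 v0; rewrite le_max u0.
have [xN|xN] := boolP (all (S :\: St) x); rewrite /= ?mulr0 ?mulr1 //.
have /forallPn[i xi] : ~~ all (S :\: St) x by [].
have : a (x i) <= \big[Num.max/0]_(i < N) a (x i) by exact: le_bigmax.
apply: le_trans; move: xi; rewrite inE negb_and negbK (forallP Sx i) orbF.
by rewrite inE => /andP[].
Qed.

(** Here [d] stands for [D q K]: the bound [1 + M <= d m^(1/p)] turns the reverse Hoelder inequality
    into [E a^(2p) <= k m^2] with [k = 3 (4 d)^(2p)], the input of Paley-Zygmund. *)
Lemma sum_max_ge_moment (R : realType) (X : finType) mid (S T : {set X}) (a : X -> R)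
    (p d : R) (N : nat) (m := (\sum_(x in S) a x `^ p) / #|S|%:R) :
  @mid_ineq R X mid -> (forall x, 0 <= a x) ->
  (forall x y z, x \in S -> y \in S -> mid x y z -> z \in T) ->
  (forall x y z, mid x y z -> a x <= 2 * a z + a y + 1) ->
  S \subset T -> 1 <= p -> 0 < m ->
  1 + ((\sum_(x in T) a x `^ p) / #|S|%:R) `^ p^-1 <= d * m `^ p^-1 ->
  (16 * d) `^ (2 * p) <= N%:R ->
  4^-1 * m `^ p^-1 <= (#|S|%:R ^+ N)^-1 *
    \sum_(x : {ffun 'I_N -> X} | [forall i, x i \in S]) \big[Num.max/0]_(i < N) a (x i).
Proof.
move=> midX a0 ST amid subST p1 m0 dm dN.
have p0 : 0 < p by lra.
have p0' : p != 0 by rewrite gt_eqF.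
have S0 : 0 < #|S|%:R :> R.
  rewrite ltr0n lt0n; apply: contraTneq m0; rewrite /m => ->.
  by rewrite invr0 mulr0 ltxx.
have leST : \sum_(x in S) a x `^ p <= \sum_(x in T) a x `^ p.
  rewrite [leRHS](big_setID S) /= (finset.setIidPr subST) lerDl sumr_ge0 // => x _.
  exact: powR_ge0.
pose M := ((\sum_(x in T) a x `^ p) / #|S|%:R) `^ p^-1.
have MpE : M `^ p * #|S|%:R = \sum_(x in T) a x `^ p.
  rewrite powRK // ?divfK ?gt_eqF // divr_ge0 ?sumr_ge0 // => x _.
  exact: powR_ge0.
have M0 : 0 < M.
  by rewrite powR_gt0 // (lt_le_trans m0) // ler_pM2r // invr_gt0.
have mp0 : 0 < m `^ p^-1 by rewrite powR_gt0.
have d0 : 0 < d by rewrite -(pmulr_lgt0 _ mp0); apply: lt_le_trans dm; rewrite addr_gt0.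
have d4 : 0 < 4 * d by rewrite mulr_gt0.
have S2 : \sum_(x in S) a x `^ (2 * p) <= 3 * (4 * d) `^ (2 * p) * m ^+ 2 * #|S|%:R.
  have := sum_mid_powR2 midX a0 ST amid subST p1 M0.
  rewrite MpE lexx => /(_ isT) /le_trans; apply; rewrite ler_pM2r // -!mulrA ler_pM2l //.
  rewrite -[m in m ^+ 2](@powRK _ _ p) ?(ltW m0) // -powR_double ?powR_ge0 //.
  rewrite -powRM ?powR_ge0 ?(ltW d4) //.
  apply: powR_le; rewrite ?mulr_ge0 ?addr_ge0 ?ler01 //; try exact: ltW.
  by rewrite -mulrA ler_pM2l // addrC.
(* Half the [p]-norm, so that [t^p <= m / 2]; the further factor 1/2 in [sum_max_ge] produces
   [c = 1/4]. *)
pose t := m `^ p^-1 / 2.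
have tm : t `^ p <= m / 2.
  rewrite powRM ?(ltW mp0) // powRK ?(ltW m0) // ler_pM2l //.
  by apply: ge1r_powR => //; lra.
have t0 : 0 <= t by rewrite divr_ge0 // ltW.
have k0 : 0 < 3 * (4 * d) `^ (2 * p) by rewrite mulr_gt0 // powR_gt0.
have S1 : \sum_(x in S) a x `^ p = m * #|S|%:R by rewrite divfK // gt_eqF.
have card := card_ge_Paley_Zygmund a0 p0 k0 m0 t0 S1 S2 tm.
(* Origin of the constant 16: [4 * 3 <= 4^2 <= 4^(2p)] and [4 * (4 d) = 16 d]. *)
have kN : 4 * (3 * (4 * d) `^ (2 * p)) <= N%:R.
  apply: le_trans dN; have -> : 16 * d = 4 * (4 * d) by ring.
  rewrite [leRHS]powRM ?(ltW d4) // mulrA ler_pM2r ?powR_gt0 //.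
  apply: (@le_trans _ _ (4 `^ 2)); first by rewrite powR_mulrn //; lra.
  by apply: ler_powR; lra.
have N0 : (0 < N)%N by rewrite -(ltr0n R); apply: lt_le_trans kN; rewrite mulr_gt0.
have := @sum_max_ge R X S a t N a0 t0 N0.
rewrite -[(#|S| <= _)%N](ler_nat R) natrM => /(_ _)H.
rewrite ler_pdivlMl ?exprn_gt0 //; apply: le_trans (H _).
  by rewrite mulrC /t le_eqVlt; apply/orP; left; apply/eqP; field.
by apply: le_trans card _; rewrite ler_wpM2r.
Qed.

(** * Comparison of integrals, and sums transported to finite types *)

(** Stated for arbitrary nonnegative functions, so that integrands built from lattice point counts
    can be used as they stand. The integral is a supremum over simple functions below the integrand,
    and [c] times one below [f] is one below [g]. *)
Lemma ge0_scale_le_integral d (T : measurableType d) (R : realType)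
    (mu : {measure set T -> \bar R}) (D : set T) (f g : T -> R) (c : R) :
  0 < c -> (forall x, 0 <= f x) -> (forall x, 0 <= g x) ->
  (forall x, D x -> c * f x <= g x) ->
  (c%:E * \int[mu]_(x in D) (f x)%:E <= \int[mu]_(x in D) (g x)%:E)%E.
Proof.
move=> c0 f0 g0 fg.
rewrite -lee_pdivlMl // ge0_integralE; last by move=> x _; rewrite lee_fin.
rewrite ge0_integralE; last by move=> x _; rewrite lee_fin.
apply: ge_ereal_sup => _ [h /= hf <-]; rewrite lee_pdivlMl // -sintegralrM.
apply: ereal_sup_ubound => /=.
exists (scale_nnsfun h (ltW c0)) => // x /=.
have := hf x; rewrite /patch; case: ifPn => [/set_mem Dx|_]; rewrite !lee_fin => hx.
  by apply: le_trans (fg x Dx); rewrite ler_pM2l.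
by rewrite -(mulr0 c) ler_pM2l.
Qed.

Lemma range_sub_seq (I : finType) (J : choiceType) (v : I -> J) (S : set J) :
  S `<=` range v -> S = [set` map v (enum [set i | v i \in S]%SET)].
Proof.
move=> Sv; apply/seteqP; split => [x Sx|x /mapP[i]].
  have [i _ vi] := Sv _ Sx; apply/mapP; exists i => //.
  by rewrite mem_enum inE vi; exact/mem_set.
by rewrite mem_enum inE => /set_mem ? ->.
Qed.

Lemma fsbig_inj (A : Type) (idx : A) (op : Monoid.com_law idx) (I : finType)
    (J : choiceType) (v : I -> J) (S : set J) (f : J -> A) :
  injective v -> S `<=` range v ->
  \big[op/idx]_(x \in S) f x = \big[op/idx]_(i in [set i | v i \in S]%SET) f (v i).
Proof.
move=> vI Sv; rewrite {1}(range_sub_seq Sv) -fsbig_seq ?map_inj_uniq ?enum_uniq //.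
by rewrite big_map big_enum.
Qed.

Lemma card_fset_set_inj (I : finType) (J : choiceType) (v : I -> J) (S : set J) :
  injective v -> S `<=` range v ->
  #|` fset_set S| = #|[set i | v i \in S]%SET|.
Proof.
move=> vI Sv; have finS : finite_set S by rewrite (range_sub_seq Sv); exact: finite_seq.
have := @fsbig_inj _ _ addn _ _ v S (fun _ => 1%N) vI Sv.
by rewrite fsbig_finite // sum1_card big_const_seq count_predT iter_addn_0 mul1n.
Qed.

(** * Lattice points of rotated bodies, coded in a box *)

(** Codes the integer points of [[-r, r]^n] by the type on which [mid_ineq_tuple] holds. The shift
    by [r] preserves [x + y - 2 z], hence the meaning of [near_mid]. *)
Definition box_point (R : realType) (n r : nat) (t : n.-tuple 'I_r.*2.+1) : 'cV[R]_n :=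
  \col_i ((tnth t i)%:R - r%:R).

Lemma box_point_inj (R : realType) (n r : nat) : injective (@box_point R n r).
Proof.
move=> s t st; apply: eq_from_tnth => i; apply: val_inj => /=.
have /matrixP/(_ i ord0) := st; rewrite !mxE => /addIr/eqP.
by rewrite eqr_nat => /eqP.
Qed.

Lemma box_point_surj (R : realType) (n r : nat) (x : 'cV[R]_n) :
  integer_lattice x -> (forall i, `|x i ord0| <= r%:R) -> range (@box_point R n r) x.
Proof.
move=> xZ xr.
have k_ex i : exists k : 'I_r.*2.+1, x i ord0 = k%:R - r%:R.
  have /intrP[m xm] := xZ i; have := xr i; rewrite xm.
  rewrite [leRHS]pmulrn -intr_norm ler_int => mr.
  have kr : (absz (m + r%:Z)%R < r.*2.+1)%N by lia.
  exists (Ordinal kr) => /=.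
  rewrite [X in X - _]pmulrn [X in _ - X]pmulrn -intrB; congr (_%:~R); lia.
have [k xk] := choice k_ex; exists [tuple k i | i < n] => //.
by apply/matrixP => i j; rewrite ord1 mxE tnth_mktuple xk.
Qed.

Lemma coord_le_norm (R : realType) (n : nat) (x : 'cV[R]_n) i : `|x i ord0| <= `|x|.
Proof.
rewrite [leRHS](mx_normrE x); exact: (le_bigmax _ (fun ij => `|x ij.1 ij.2|) (i, ord0)).
Qed.

Lemma orthogonal_trmx (R : realType) (n : nat) (U : 'M[R]_n) :
  orthogonal_group U -> U *m U^T = 1%:M.
Proof. exact: mulmx1C. Qed.

Lemma orthogonal_entry_le1 (R : realType) (n : nat) (U : 'M[R]_n) i j :
  orthogonal_group U -> `|U i j| <= 1.
Proof.
move=> /orthogonal_trmx /matrixP/(_ i i); rewrite !mxE eqxx => U1.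
rewrite -(@ler_pXn2r _ 2) ?nnegrE // expr1n real_normK ?num_real // -[leRHS]U1.
rewrite (bigD1 j) //= mxE expr2 lerDl sumr_ge0 // => k _.
by rewrite mxE -expr2 sqr_ge0.
Qed.

Lemma dot_last_basis (R : realType) (m : nat) (x : 'cV[R]_m.+1) :
  dot x (last_basis R m) = x ord_max ord0.
Proof.
rewrite /dot mxE (bigD1 ord_max) //= !mxE eqxx mulr1 big1 ?addr0 // => i im.
by rewrite !mxE (negbTE im) mulr0.
Qed.

(** [e_n] is the image of the unit vector [U^T e_n]. This point keeps the lattice points nonempty
    and the moments of the height positive for every [U]. *)
Lemma last_basis_mx_image (R : realType) (m : nat) (U : 'M[R]_m.+1) (K : set 'cV[R]_m.+1) :
  orthogonal_group U -> @euclidean_ball R m.+1 `<=` K ->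
  lattice_points (mx_image U K) (last_basis R m).
Proof.
move=> UO BK; split; last first.
  by move=> i; rewrite mxE; case: (_ && _).
exists (U^T *m last_basis R m) => [|/=]; last by rewrite mulmxA orthogonal_trmx // mul1mx.
apply: BK; rewrite /euclidean_ball /= /dot trmx_mul trmxK mulmxA -(mulmxA _ U) orthogonal_trmx //.
rewrite mulmx1; have := @dot_last_basis R m (last_basis R m); rewrite /dot => ->.
by rewrite mxE !eqxx sqrtr1.
Qed.

Lemma sub_minkowski_cube (R : realType) (n : nat) (L : set 'cV[R]_n) :
  L `<=` minkowski_sum L (@open_cube R n).
Proof.
move=> x Lx; exists x => //; exists 0; last by rewrite addr0.
by move=> i; rewrite mxE ltr01 oppr_lt0 ltr01.
Qed.

(** Entries of an orthogonal matrix are at most 1 in absolute value, so one [r] serves all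
    rotations; the supremum in [D] needs this uniformity. *)
Lemma mx_image_cube_bounded (R : realType) (n : nat) (K : set 'cV[R]_n) :
  compact K -> exists r : nat, forall (U : 'M[R]_n) x i, orthogonal_group U ->
    minkowski_sum (mx_image U K) (@open_cube R n) x -> `|x i ord0| <= r%:R.
Proof.
move=> /compact_bounded[b0 [_ /(_ (b0 + 1))]]; rewrite ltrDl ltr01 => /(_ isT).
move: (b0 + 1) => b Kb.
exists (Num.bound (n%:R * `|b| + 1)) => U x i UO [_ [k Kk <-] [c cC <-]].
rewrite mxE (le_trans (ler_normD _ _)) //.
have c1 : `|c i ord0| <= 1 by rewrite ler_norml; have /andP[/ltW -> /ltW ->] := cC i.
have Uk : `|(U *m k) i ord0| <= n%:R * `|b|.
  rewrite mxE (le_trans (ler_norm_sum _ _ _)) //.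
  rewrite mulr_natl -[n in _ *+ n]card_ord -sumr_const ler_sum // => j _.
  rewrite normrM -[leRHS]mul1r ler_pM // ?orthogonal_entry_le1 //.
  by rewrite (le_trans (coord_le_norm _ _)) // (le_trans (Kb _ Kk)) // ler_norm.
rewrite (le_trans (lerD Uk c1)) // ltW //.
by apply: archi_boundP; rewrite addr_ge0 // mulr_ge0.
Qed.

Lemma mx_image_midpoint (R : realType) (n : nat) (U : 'M[R]_n) (K : set 'cV[R]_n) x y :
  @convex_set R 'cV[R]_n K -> mx_image U K x -> mx_image U K y ->
  mx_image U K (2^-1 *: (x + y)).
Proof.
move=> Kc [k Kk <-] [l Kl <-]; exists (2^-1 *: (k + l)); last first.
  by rewrite -scalemxAr mulmxDr.
have h0 : 0 <= 2^-1 :> R by [].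
have h1 : 2^-1 <= 1 :> R by lra.
have := Kc k l (Itv01 h0 h1) (mem_set Kk) (mem_set Kl) => /set_mem.
rewrite /conv /= scalerDr; congr (K (_ + _)); congr (_ *: _); rewrite /unstable.onem; lra.
Qed.

Lemma box_point_integer (R : realType) (n r : nat) (t : n.-tuple 'I_r.*2.+1) :
  integer_lattice (box_point R t).
Proof. by move=> i; rewrite mxE rpredB // natr_int. Qed.

Definition box_points (R : realType) (n r : nat) (L : set 'cV[R]_n) :
    {set n.-tuple 'I_r.*2.+1} :=
  [set t | box_point R t \in lattice_points L]%SET.

Lemma mem_box_points (R : realType) (n r : nat) (L : set 'cV[R]_n) (t : n.-tuple 'I_r.*2.+1) :
  (t \in box_points r L) <-> L (box_point R t).
Proof.
rewrite inE; split=> [/set_mem[]//|Lt]; apply/mem_set; split => //.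
exact: box_point_integer.
Qed.

Definition height (R : realType) (m r : nat) (t : m.+1.-tuple 'I_r.*2.+1) : R :=
  `|dot (box_point R t) (last_basis R m)|.

Lemma height_le (R : realType) (m r : nat) (t : m.+1.-tuple 'I_r.*2.+1) : height R t <= r%:R.
Proof.
rewrite /height dot_last_basis mxE ler_norml.
have : (tnth t ord_max <= r + r)%N by have := ltn_ord (tnth t ord_max); lia.
rewrite -(ler_nat R) natrD; have : 0 <= (tnth t ord_max)%:R :> R by [].
by move=> *; apply/andP; split; lra.
Qed.

Lemma lattice_expectation_box (R : realType) (n r : nat) (L : set 'cV[R]_n) f :
  lattice_points L `<=` range (@box_point R n r) ->
  lattice_expectation L f =
    (\sum_(t in box_points r L) f (box_point R t)) / #|box_points r L|%:R.
Proof.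
move=> Lbox; rewrite /lattice_expectation /G (card_fset_set_inj (@box_point_inj R n r) Lbox).
by rewrite (fsbig_inj _ _ (@box_point_inj R n r) Lbox) mulrC.
Qed.

(** * The quantity [D0] in the box, and its boundedness *)

(** The ratio of lattice point counts in [D0] changes the normalization of the moment over [T] from
    [|T|] to [|S|]. *)
Lemma D0_box (R : realType) (m r : nat) (L : set 'cV[R]_m.+1) (p : R)
    (T := box_points r (minkowski_sum L (@open_cube R m.+1))) (S := box_points r L) :
  lattice_points (minkowski_sum L (@open_cube R m.+1)) `<=` range (@box_point R m.+1 r) ->
  (0 < #|S|)%N ->
  D0 L p = (1 + ((\sum_(t in T) height R t `^ p) / #|S|%:R) `^ p^-1)
           / ((\sum_(t in S) height R t `^ p) / #|S|%:R) `^ p^-1.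
Proof.
move=> LCbox S0.
have Lbox : lattice_points L `<=` range (@box_point R m.+1 r).
  by apply: subset_trans LCbox => x [Lx xZ]; split => //; exact: sub_minkowski_cube.
rewrite /D0 !(@lattice_expectation_box R m.+1 r) // -/S -/T.
rewrite /G !(card_fset_set_inj (@box_point_inj R m.+1 r)) // -/(box_points r _) -/S -/T.
have ST : S \subset T.
  apply/fintype.subsetP => t /mem_box_points Lt; apply/mem_box_points.
  exact: sub_minkowski_cube.
have T0 : (0 < #|T|)%N by rewrite (leq_trans S0) // subset_leq_card.
have sum0 (V : {set m.+1.-tuple 'I_r.*2.+1}) : 0 <= \sum_(t in V) height R t `^ p.
  by rewrite sumr_ge0 // => t _; exact: powR_ge0.
rewrite -/(box_points r L) -/S -powRM ?divr_ge0 //.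
by rewrite mulrA divfK // pnatr_eq0 -lt0n.
Qed.

(** A crude bound, uniform in the rotation and in [p <= q]; it serves to make the supremum in [D]
    that of a bounded set. *)
Lemma D0_le (R : realType) (m r : nat) (L : set 'cV[R]_m.+1) (p q : R)
    (w : R := (#|{: m.+1.-tuple 'I_r.*2.+1}|)%:R) :
  lattice_points (minkowski_sum L (@open_cube R m.+1)) `<=` range (@box_point R m.+1 r) ->
  lattice_points L (last_basis R m) -> 1 <= p <= q ->
  D0 L p <= (1 + w * r.+1%:R `^ q) * w.
Proof.
move=> LCbox en /andP[p1 pq].
have Lbox : lattice_points L `<=` range (@box_point R m.+1 r).
  by apply: subset_trans LCbox => x [Lx xZ]; split => //; exact: sub_minkowski_cube.
have [e _ eE] := Lbox _ en.
have eL : e \in box_points r L by apply/mem_box_points; rewrite eE; case: en.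
have S0 : (0 < #|box_points r L|)%N by apply/card_gt0P; exists e.
have s1 : 1 <= #|box_points r L|%:R :> R by rewrite ler1n.
have he : height R e = 1 by rewrite /height eE dot_last_basis mxE !eqxx normr1.
have cardw (V : {set m.+1.-tuple 'I_r.*2.+1}) : #|V|%:R <= w by rewrite ler_nat max_card.
have w1 : 1 <= w by exact: le_trans s1 (cardw _).
clearbody w.
have w0 : 0 < w by lra.
(* With [r.+1] in place of [r] the base is at least 1, so its powers increase with the exponent. *)
have r1 : 1 <= r.+1%:R :> R by rewrite ler1n.
have p01 : p^-1 <= 1 by rewrite invf_le1 //; lra.
have p0 : 0 <= p by lra.
have pV0 : 0 <= p^-1 by rewrite invr_ge0.
have rq1 : 1 <= r.+1%:R `^ q :> R.
  by have q0 : 0 <= q; [lra|have := ler_powR r1 q0; rewrite powRr0].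
have wrq1 : 1 <= w * r.+1%:R `^ q by rewrite mulr_ege1.
rewrite (D0_box p LCbox S0); set T := box_points r _; set S := box_points r L.
(* The point [e_n] alone contributes [1 / |S| >= 1 / w] to the mean. *)
have den : w^-1 <= ((\sum_(t in S) height R t `^ p) / #|S|%:R) `^ p^-1.
  have wV01 : 0 < w^-1 <= 1 by rewrite invr_gt0 invf_le1 // w0.
  apply: (le_trans (ger1_powR wV01 p01)).
  apply: powR_le; [by []|by rewrite invr_ge0; lra|].
  rewrite -[leLHS]mul1r; apply: ler_pM => //; first by rewrite invr_ge0; lra.
    rewrite (bigD1 e) //= he powR1 lerDl sumr_ge0 // => t _; exact: powR_ge0.
  by rewrite lef_pV2 ?posrE ?ltr0n.
have num : ((\sum_(t in T) height R t `^ p) / #|S|%:R) `^ p^-1 <= w * r.+1%:R `^ q.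
  apply: le_trans (ler1_powR wrq1 p01).
  apply: powR_le => //; first by rewrite divr_ge0 // sumr_ge0 // => t _; exact: powR_ge0.
  rewrite ler_pdivrMr; last by lra.
  apply: (@le_trans _ _ (w * r.+1%:R `^ q)); last by rewrite ler_peMr //; lra.
  apply: (@le_trans _ _ (\sum_(t in T) r.+1%:R `^ q)).
    apply: ler_sum => t _; apply: le_trans (ler_powR r1 pq); apply: powR_le => //.
      exact: normr_ge0.
    by rewrite (le_trans (height_le _ _)) // ler_nat.
  by rewrite sumr_const -[_ *+ #|_|]mulr_natl ler_wpM2r ?powR_ge0 //.
rewrite ler_pdivrMr; last by apply: lt_le_trans den; rewrite invr_gt0; lra.
rewrite -mulrA -[leLHS]mulr1; apply: ler_pM => //.
- by rewrite addr_ge0 // powR_ge0.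
- by rewrite lerD2l.
- by rewrite -(ler_pM2l (_ : 0 < w^-1)) ?invr_gt0 ?mulKf ?gt_eqF //; lra.
Qed.

(** * The inequality for a fixed rotation *)

Lemma near_mid_nat (R : realType) (x y z : nat) : near_mid x y z ->
  x%:R + y%:R <= 2 * z%:R + 1 :> R /\ 2 * z%:R <= x%:R + y%:R + 1 :> R.
Proof.
by rewrite /near_mid -!(ler_nat R) -muln2 -2!natr1 natrD natrM mulrC => /andP[].
Qed.

(** Triangle inequality for [x = 2 z - y + (x + y - 2 z)]; it supplies [amid] for heights. *)
Lemma norm_near_mid (R : realType) (x y z : R) :
  x + y <= 2 * z + 1 -> 2 * z <= x + y + 1 -> `|x| <= 2 * `|z| + `|y| + 1.
Proof.
have := ler_norm z; have := ler_norm (- z); have := ler_norm y; have := ler_norm (- y).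
rewrite !normrN ler_norml => ? ? ? ? ? ?; apply/andP; split; lra.
Qed.

(** The choice of [p] makes [(16 d)^(2p) = N], and the two bounds on [N] give [1 <= p <= q], the
    range in which [d] dominates [D0 L p]. *)
Lemma moment_le_mean_max (R : realType) (m : nat) (K : set 'cV[R]_m.+1) (q : R) (N : nat)
    (U : 'M[R]_m.+1) (L := mx_image U K) (d := D q K) (p := ln N%:R / (2 * ln (16 * d))) :
  convex_body K -> @euclidean_ball R m.+1 `<=` K -> 1 <= q ->
  (16 * d) ^+ 2 <= N%:R -> N%:R <= expR q -> orthogonal_group U ->
  4^-1 * ((G L)%:R^-1 * \sum_(x \in lattice_points L) `|dot x (last_basis R m)| `^ p) `^ p^-1
  <= ((G L)%:R ^+ N)^-1 * \sum_(x \in @lattice_tuples R m.+1 N L)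
             \big[Num.max/0]_(i < N) `|dot (x i) (last_basis R m)|.
Proof.
move=> [Kcpt Kconv _] BK q1 dN Nq UO.
have [r rP] := mx_image_cube_bounded Kcpt.
have LCbox V : orthogonal_group V ->
    lattice_points (minkowski_sum (mx_image V K) (@open_cube R m.+1))
      `<=` range (@box_point R m.+1 r).
  by move=> VO x [xL xZ]; apply: box_point_surj => // i; exact: rP VO xL.
have Lbox : lattice_points L `<=` range (@box_point R m.+1 r).
  by apply: subset_trans (LCbox U UO) => x [Lx xZ]; split => //; exact: sub_minkowski_cube.
have D0d s : 1 <= s <= q -> D0 L s <= d.
  (* Boundedness from [D0_le] rules out the default value 0 of [sup]. *)
  move=> s1q; apply: ub_le_sup; last by exists U, s.
  eexists => _ [V [s' [VO s'q ->]]]; apply: D0_le s'q; first exact: LCbox.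
  exact: last_basis_mx_image.
pose S := box_points r L.
pose T := box_points r (minkowski_sum L (@open_cube R m.+1)).
have en : lattice_points L (last_basis R m) by exact: last_basis_mx_image.
have [e _ eE] := Lbox _ en.
have eS : e \in S by apply/mem_box_points; rewrite eE; case: en.
have S0 : (0 < #|S|)%N by apply/card_gt0P; exists e.
have S0R : 0 < #|S|%:R :> R by rewrite ltr0n.
have he : height R e = 1 by rewrite /height eE dot_last_basis mxE !eqxx normr1.
have a0 (t : m.+1.-tuple 'I_r.*2.+1) : 0 <= height R t by exact: normr_ge0.
have m0 s : 0 < (\sum_(t in S) height R t `^ s) / #|S|%:R.
  rewrite divr_gt0 // (bigD1 e) //= he powR1 ltr_pwDl // sumr_ge0 // => t _.
  exact: powR_ge0.
have key s : 1 <= s <= q -> 1 + ((\sum_(t in T) height R t `^ s) / #|S|%:R) `^ s^-1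
    <= d * ((\sum_(t in S) height R t `^ s) / #|S|%:R) `^ s^-1.
  move=> /D0d; rewrite (D0_box s (LCbox U UO)) // ler_pdivrMr //.
  by rewrite powR_gt0.
have subST : S \subset T.
  apply/fintype.subsetP => t /mem_box_points Lt; apply/mem_box_points.
  exact: sub_minkowski_cube.
(* As [S] lies in [T], the numerator of [D0 L 1] dominates its denominator. *)
have d1 : 1 <= d.
  have mp := powR_gt0 1^-1 (m0 1); rewrite -(ler_pM2r mp) mul1r.
  apply: (le_trans _ (key 1 _)); last by rewrite lexx.
  apply: ler_wpDl => //; apply: powR_le; [by rewrite invr_ge0|exact: ltW|].
  rewrite ler_pM2r ?invr_gt0 // [leRHS](big_setID S) /= (finset.setIidPr subST) lerDl.
  by rewrite sumr_ge0 // => t _; exact: powR_ge0.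
have d16 : 16 <= 16 * d by rewrite ler_peMr.
have d160 : 0 < 16 * d by exact: lt_le_trans d16.
(* By [ln y >= 1 - 1/y] at [y = 16 d >= 16]. *)
have ln16 : 1 <= 2 * ln (16 * d).
  have : ln (16 * d)^-1 <= (16 * d)^-1 - 1.
    have -> : (16 * d)^-1 = 1 + ((16 * d)^-1 - 1) by rewrite addrC subrK.
    rewrite [X in _ <= X - 1]addrC subrK.
    by apply: le_ln1Dx; rewrite ltrBrDl subrr invr_gt0.
  rewrite lnV ?posrE //.
  have : (16 * d)^-1 <= 16^-1 by rewrite lef_pV2 ?posrE.
  lra.
have ln0 : 0 < 2 * ln (16 * d) by exact: lt_le_trans ln16.
have N0 : 0 < N%:R :> R by apply: lt_le_trans dN; rewrite exprn_gt0.
have p1 : 1 <= p.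
  rewrite ler_pdivlMr // mul1r -[2]/(2%:R) mulr_natl -lnXn //.
  by rewrite ler_ln ?posrE ?exprn_gt0.
have pq : p <= q.
  rewrite ler_pdivrMr //; apply: (@le_trans _ _ q); last by rewrite ler_peMr //; lra.
  by rewrite -(expRK q) ler_ln ?posrE ?expR_gt0.
have dNp : (16 * d) `^ (2 * p) <= N%:R.
  rewrite /powR gt_eqF //.
  have -> : 2 * p * ln (16 * d) = ln N%:R.
    by rewrite /p; field; rewrite gt_eqF //; lra.
  by rewrite lnK ?posrE.
have mid := @mid_ineq_tuple R r.*2.+1 m.+1.
have midST (x y z : m.+1.-tuple 'I_r.*2.+1) : x \in S -> y \in S ->
    [forall i, near_mid (tnth x i) (tnth y i) (tnth z i)] -> z \in T.
  move=> /mem_box_points xL /mem_box_points yL /forallP xyz; apply/mem_box_points.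
  (* The exact midpoint lies in [L] by convexity, and [z] differs from it by at most 1/2 in each
     coordinate, hence by an element of the open cube. *)
  exists (2^-1 *: (box_point R x + box_point R y)); first exact: mx_image_midpoint.
  exists (box_point R z - 2^-1 *: (box_point R x + box_point R y)); last by rewrite addrC subrK.
  move=> i; rewrite !mxE; have /(near_mid_nat R)[h1 h2] := xyz i.
  by apply/andP; split; lra.
have amid (x y z : m.+1.-tuple 'I_r.*2.+1) :
    [forall i, near_mid (tnth x i) (tnth y i) (tnth z i)] ->
    height R x <= 2 * height R z + height R y + 1.
  move=> /forallP/(_ ord_max)/(near_mid_nat R)[h1 h2]; rewrite /height !dot_last_basis !mxE.
  by apply: norm_near_mid; lra.
have := sum_max_ge_moment mid a0 midST amid subST p1 (m0 p) (key p _) dNp.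
rewrite p1 pq => /(_ isT).
have -> : (G L)%:R^-1 * \sum_(x \in lattice_points L) `|dot x (last_basis R m)| `^ p
    = (\sum_(t in S) height R t `^ p) / #|S|%:R.
  exact: (@lattice_expectation_box R m.+1 r L (fun x => `|dot x (last_basis R m)| `^ p)).
move=> /le_trans; apply.
rewrite /G (card_fset_set_inj (@box_point_inj R m.+1 r) Lbox) -/(box_points r L) -/S.
rewrite ler_pM2l ?invr_gt0 ?exprn_gt0 //.
pose v (x : {ffun 'I_N -> m.+1.-tuple 'I_r.*2.+1}) := [ffun i => box_point R (x i)].
have vI : injective v.
  move=> x y /ffunP xy; apply/ffunP => i; apply: (@box_point_inj R m.+1 r).
  by have := xy i; rewrite !ffunE.
have vT : @lattice_tuples R m.+1 N L `<=` range v.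
  move=> x xL; have t_ex i : exists t : m.+1.-tuple 'I_r.*2.+1, box_point R t = x i.
    by have [t _ <-] := Lbox _ (xL i); exists t.
  have [t tx] := choice t_ex.
  by exists [ffun i => t i] => //; apply/ffunP => i; rewrite !ffunE.
rewrite (fsbig_inj _ _ vI vT) le_eqVlt; apply/orP; left; apply/eqP.
apply: eq_big => [x|x _]; last by apply: eq_bigr => i _; rewrite ffunE.
rewrite inE; apply/forallP/idP => [xS|/set_mem xS i].
  by apply/mem_set => i; rewrite ffunE; have := xS i; rewrite inE => /set_mem.
by rewrite inE; apply/mem_set; have := xS i; rewrite ffunE.
Qed.

Theorem corollary1p1 (R : realType) :
  exists c C : R, [/\ 0 < c, 0 < C &
    forall (m : nat) (nu : probability (borel_matrix R m.+1) R)
           (K : set 'cV[R]_m.+1) (q : R) (N : nat),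
      haar_orthogonal nu ->
      convex_body K ->
      @euclidean_ball R m.+1 `<=` K ->
      1 <= q ->
      (C * D q K) ^+ 2 <= N%:R ->
      N%:R <= expR q ->
      (c%:E *
         \int[nu]_(U in @orthogonal_group R m.+1)
           ((((G (mx_image U K))%:R^-1 *
              \sum_(x \in lattice_points (mx_image U K))
                `|dot x (last_basis R m)| `^ (ln N%:R / (2 * ln (C * D q K))))
             `^ (2 * ln (C * D q K) / ln N%:R))%:E)
       <=
       \int[nu]_(U in @orthogonal_group R m.+1)
         (((G (mx_image U K))%:R ^+ N)^-1 *
           \sum_(x \in @lattice_tuples R m.+1 N (mx_image U K))
             \big[Num.max/0]_(i < N) `|dot (x i) (last_basis R m)|)%:E)%E].
Proof.
exists 4^-1, 16; split => // m nu K q N _ Kbody BK q1 dN Nq.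
apply: (@ge0_scale_le_integral _ (borel_matrix R m.+1) R nu) => // [U|U|U UO].
- exact: powR_ge0.
- rewrite mulr_ge0 ?invr_ge0 ?exprn_ge0 // fsumr_ge0 // => x _.
  by elim/big_ind: _ => // u v u0 v0; rewrite le_max u0.
have -> : 2 * ln (16 * D q K) / ln N%:R = (ln N%:R / (2 * ln (16 * D q K)))^-1.
  by rewrite invf_div.
exact: moment_le_mean_max.
Qed.
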